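(* Let $\Gamma$ be a connected graph and let $\mathcal{E}\subset\mathcal{E}^{L}(\Gamma)$ be a set of embeddings of $\Gamma$. Then the number $n(\mathcal{E},\Gamma)$ of unrooted maps in $\mathcal{E}$ is $$n(\mathcal{E},\Gamma)=\frac{1}{|\mathrm{Aut}\,\Gamma\times\langle\alpha\rangle|}\sum_{g\in \mathrm{Aut}\,\Gamma\times\langle\alpha\rangle}|\Phi(g)|,$$ where $\Phi(g)=\{\mathcal{P}\mid \mathcal{P}\in\mathcal{E}\text{ and }\mathcal{P}^{g}=\mathcal{P}\}$.
   Context: Graphs are finite, connected and simple with maximum valency at least $3$; surfaces are compact, closed, 2-dimensional, without boundary. Maps. Let $X$ be a finite set and $K=\{1,\alpha,\beta,\alpha\beta\}$ the Klein four-group. Let $\mathcal{X}_{\alpha,\beta}$ be the disjoint union of the quadricells $Kx=\{x,\alpha x,\beta x,\alpha\beta x\}$, $x\in X$. A map $M=(\mathcal{X}_{\alpha,\beta},\mathcal{P})$ is a permutation $\mathcal{P}$ of $\mathcal{X}_{\alpha,\beta}$ such that: (i) for every $x$ there is no integer $k$ with $\mathcal{P}^kx=\alpha x$; (ii) $\alpha\mathcal{P}=\mathcal{P}^{-1}\alpha$; (iii) the group $\langle\alpha,\beta,\mathcal{P}\rangle$ is transitive on $\mathcal{X}_{\alpha,\beta}$. Vertices of $M$ are the pairs of conjugate cycles $\{(x,\mathcal{P}x,\ldots),(\alpha x,\mathcal{P}^{-1}\alpha x,\ldots)\}$ of $\mathcal{P}$; edges are the quadricells. The resulting graph $\Gamma(M)$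 is the underlying graph of $M$. Embeddings. An embedding of $\Gamma$ is a pair consisting of a rotation system of $\Gamma$ and a function $\lambda:E(\Gamma)\to\mathbb{Z}_2$; it is represented by a map $(\mathcal{X}_{\alpha,\beta},\mathcal{P})$ with $X=E(\Gamma)$ and underlying graph $\Gamma$, and is identified with $\mathcal{P}$. $\mathcal{E}^{L}(\Gamma)$ denotes the set of embeddings of $\Gamma$ on locally orientable surfaces (i.e. orientable or non-orientable). Isomorphism. Maps $(\mathcal{X}^1_{\alpha,\beta},\mathcal{P}_1)$, $(\mathcal{X}^2_{\alpha,\beta},\mathcal{P}_2)$ are isomorphic if there is a bijection $\tau:\mathcal{X}^1_{\alpha,\beta}\to\mathcal{X}^2_{\alpha,\beta}$ with $\tau\alpha=\alpha\tau$, $\tau\beta=\beta\tau$, $\tau\mathcal{P}_1=\mathcal{P}_2\tau$. The number of unrooted maps in a set of embeddings is the number of isomorphism classes of maps in it. Action. Writing the quadricell of an edge $uv$ as $\{u^{v+},u^{v-},v^{u+},v^{u-}\}$ with $\alpha$ exchanging $u^{v+},u^{v-}$ and $\beta$ exchanging $u^{v\pm},v^{u\pm}$, an element $g\in\mathrm{Aut}\,\Gamma$ acts on $\mathcal{X}_{\alpha,\beta}$ by $u^{v\pm}\mapsto g(u)^{g(v)\pm}$ (so $g\alpha=\alpha g$, $g\beta=\beta g$). For $g\in\mathrm{Aut}\,\Gamma\times\langle\alpha\rangle$, $\mathcal{P}^g=g\mathcal{P}g^{-1}$.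
   Formalization: The set of embeddings is assumed closed under Aut Γ × ⟨α⟩, and an embedding means the set of all maps representing a pair (rotation system, λ), so P^g = P is equality of such sets and α fixes each; with single permutations P, or E not closed, the formula fails (e.g. for K_4). *)

(* Defs.v *)
From mathcomp Require Import all_boot all_order all_algebra all_fingroup.

Set Implicit Arguments.
Unset Strict Implicit.
Unset Printing Implicit Defensive.

Import GroupScope.

(** * Maps *)

Section Maps.

(* The flag set is any finite type on which alpha and beta generate a free
   action of the Klein four-group, i.e. a disjoint union of quadricells. *)
Definition quadricells (T : finType) (alpha beta : {perm T}) : bool :=
  [forall x, [&& alpha (alpha x) == x, beta (beta x) == x,
                 alpha (beta x) == beta (alpha x),
                 alpha x != x, beta x != x & alpha (beta x) != x]].

Definition is_map (T : finType) (alpha beta P : {perm T}) : bool :=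
  [&& quadricells alpha beta,
      [forall x, alpha x \notin porbit P x],
      [forall x, alpha (P x) == P^-1 (alpha x)]
    & [transitive <<[set alpha; beta; P]>>, on [set: T] | 'P]].

(* Pair of conjugate cycles through x, as a set of flags. *)
Definition map_vertex (T : finType) (alpha P : {perm T}) (x : T) : {set T} :=
  porbit P x :|: porbit P (alpha x).

Definition map_iso (T1 T2 : finType) (alpha1 beta1 P1 : {perm T1})
    (alpha2 beta2 P2 : {perm T2}) : bool :=
  [exists tau : {ffun T1 -> T2},
     [&& injectiveb tau, [forall y, y \in codom tau],
         [forall x, tau (alpha1 x) == alpha2 (tau x)],
         [forall x, tau (beta1 x) == beta2 (tau x)]
       & [forall x, tau (P1 x) == P2 (tau x)]]].

End Maps.

(** * Graphs *)

Record sgraph := SGraph {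
  vertex :> finType;
  adj : rel vertex;
  adj_sym : symmetric adj;
  adj_irr : irreflexive adj
}.

Definition connected_graph (G : sgraph) : Prop :=
  forall u v : G, connect (@adj G) u v.

Definition valency (G : sgraph) (u : G) : nat := #|[set v | adj u v]|.

Definition max_valency (G : sgraph) : nat := (\max_(u : G) valency u)%N.

Definition graph_aut (G : sgraph) : {set {perm G}} :=
  [set g : {perm G} | [forall u, forall v, adj (g u) (g v) == adj u v]].

Lemma graph_aut_group_set G : group_set (graph_aut G).
Proof.
apply/group_setP; split=> [|g h].
  by rewrite inE; apply/forallP=> u; apply/forallP=> v; rewrite !perm1.
rewrite !inE => /forallP Hg /forallP Hh.
apply/forallP=> u; apply/forallP=> v; rewrite !permM.
by rewrite (eqP (forallP (Hh _) _)) (eqP (forallP (Hg _) _)).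
Qed.
Canonical graph_aut_group G := Group (graph_aut_group_set G).

Section Flags.
Variable G : sgraph.

Definition dart := {d : G * G | adj d.1 d.2}.

Definition dtail (d : dart) : G := (val d).1.
Definition dhead (d : dart) : G := (val d).2.

Lemma drev_subproof (d : dart) : adj (dhead d) (dtail d).
Proof. by rewrite adj_sym; exact: (valP d). Qed.
Definition drev (d : dart) : dart := exist _ (dhead d, dtail d) (drev_subproof d).

Lemma drevK : involutive drev.
Proof. by move=> d; apply: val_inj; rewrite /= -surjective_pairing. Qed.

Definition is_edge (A : {set G}) : bool :=
  [exists u, exists v, adj u v && (A == [set u; v])].
Definition edge := {A : {set G} | is_edge A}.

Lemma edge_of_subproof (d : dart) : is_edge [set dtail d; dhead d].
Proof.
apply/existsP; exists (dtail d); apply/existsP; exists (dhead d).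
by rewrite eqxx andbT; exact: (valP d).
Qed.
Definition edge_of (d : dart) : edge := exist is_edge _ (edge_of_subproof d).

(* The flag ((u, v), false) is u^{v+} and ((u, v), true) is u^{v-}. *)
Definition flag := (dart * bool)%type.

Definition swap_side (x : flag) : flag := (x.1, ~~ x.2).
Definition swap_end (x : flag) : flag := (drev x.1, x.2).

Lemma swap_sideK : involutive swap_side.
Proof. by move=> [d b]; rewrite /swap_side /= negbK. Qed.
Lemma swap_endK : involutive swap_end.
Proof. by move=> [d b]; rewrite /swap_end /= drevK. Qed.

Definition alpha : {perm flag} := perm (inv_inj swap_sideK).
Definition beta : {perm flag} := perm (inv_inj swap_endK).

(** * Embeddings *)

Definition rotation_system (rho : {perm dart}) : bool :=
  [forall d, porbit rho d == [set d' | dtail d' == dtail d]].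

Definition underlying_graph_is (P : {perm flag}) : bool :=
  [forall x, map_vertex alpha P x == [set y : flag | dtail y.1 == dtail x.1]].

(* The map P represents the pair (rho, lambda), lambda : E -> Z_2 being written
   with bool for Z_2.  At each vertex u, one of the two conjugate cycles of P
   lists one flag u^{v s(u,v)} per neighbour v, in the order rho.  The flags
   chosen at the two ends of an edge are x and (alpha beta) x when
   lambda = 0 (untwisted edge), and x and beta x when lambda = 1 (twisted). *)
Definition represents (rho : {perm dart}) (lambda : {ffun edge -> bool})
    (P : {perm flag}) : bool :=
  [&& is_map alpha beta P, underlying_graph_is P
    & [exists s : {ffun dart -> bool}, forall d,
         (P (d, s d) == (rho d, s (rho d))) &&
         (lambda (edge_of d) == (s d == s (drev d)))]].

(* The signs s are not determined by (rho, lambda): each edge leaves the choice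
   of which side is called +.  So an embedding has several representing maps,
   which differ by exchanging u^{v+} with u^{v-} and v^{u+} with v^{u-} on some
   edges uv; it is identified with the set of all of them.  Such an exchange is
   an isomorphism of maps, but is in general not induced by Aut G x <alpha>: for
   K_4 there are 4096 single permutations P and only 64 embeddings, and orbit
   counting gives the 11 isomorphism classes on the latter, 114 on the former. *)
Definition embedding := {set {perm flag}}.

Definition embedding_of (rho : {perm dart}) (lambda : {ffun edge -> bool}) :
    embedding :=
  [set P | represents rho lambda P].

Definition EL : {set embedding} :=
  [set R : embedding |
     [exists rho : {perm dart}, exists lambda : {ffun edge -> bool},
        rotation_system rho && (R == embedding_of rho lambda)]].

(** * The action of Aut G x <alpha> *)

(* The insubd defaults are never reached when g is an automorphism, see
   flag_autE below. *)
Definition flag_map (g : {perm G}) (x : flag) : flag :=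
  (insubd x.1 (g (dtail x.1), g (dhead x.1)), x.2).
Definition flag_aut (g : {perm G}) : {perm flag} :=
  insubd (1 : {perm flag}) [ffun x => flag_map g x].

Lemma flag_autE (g : {perm G}) (x : flag) : g \in graph_aut G ->
  [/\ dtail (flag_aut g x).1 = g (dtail x.1),
      dhead (flag_aut g x).1 = g (dhead x.1)
    & (flag_aut g x).2 = x.2].
Proof.
rewrite inE => /forallP Hg.
have E (y : flag) : val (flag_map g y).1 = (g (dtail y.1), g (dhead y.1)).
  rewrite val_insubd /= (eqP (forallP (Hg _) _)).
  by have /= -> := valP y.1.
have I : injectiveb [ffun y => flag_map g y].
  apply/injectiveP=> y z; rewrite !ffunE => yz.
  have := E y; rewrite yz E => -[/perm_inj t /perm_inj h].
  have b : y.2 = z.2 by case: yz.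
  case: y z t h b {yz} => [[[? ?] ?] ?] [[[? ?] ?] ?] /= t h ->.
  by congr pair; apply: val_inj; congr pair.
have -> : flag_aut g x = flag_map g x.
  by rewrite -pvalE /flag_aut val_insubd I ffunE.
by rewrite /dtail /dhead E.
Qed.

(* The external direct product Aut G x <alpha>, with a pair (g, a) acting on
   flags as the composite of g and a. *)
Definition AutA : {set {perm G} * {perm flag}} := setX (graph_aut G) <[alpha]>.
Definition flag_act (g : {perm G} * {perm flag}) : {perm flag} :=
  flag_aut g.1 * g.2.

(* In MathComp, P ^ h is h^-1 * P * h with permutations composed from left to
   right, which is h P h^-1 for functions. *)
Definition embedding_act (P : embedding) (g : {perm G} * {perm flag}) :
    embedding :=
  [set Q ^ flag_act g | Q in P].

Definition embedding_iso (P1 P2 : embedding) : bool :=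
  [exists Q1 in P1, exists Q2 in P2, map_iso alpha beta Q1 alpha beta Q2].

Definition num_unrooted (E : {set embedding}) : nat :=
  #|equivalence_partition embedding_iso E|.

Definition Phi (E : {set embedding}) (g : {perm G} * {perm flag}) :
    {set embedding} :=
  [set P in E | embedding_act P g == P].

End Flags.

(* Main.v *)
Require Import Defs.
From mathcomp Require Import all_boot all_order all_algebra all_fingroup.

Set Implicit Arguments.
Unset Strict Implicit.
Unset Printing Implicit Defensive.

(** The formula is orbit counting for the action of Aut G x <alpha> on E; what
    has to be shown is that its orbits are the isomorphism classes, although an
    isomorphism of maps need not come from Aut G x <alpha>.

    An embedding is a set of maps, and that set has a simple shape.  Let a
    switching be a permutation of the flags that exchanges the two sides of
    each edge in some set of edges.  The maps that represent (rho, lambda) are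
    exactly the conjugates of one map built from rho alone by sign changes s on
    the darts, with lambda(uv) = 0 iff s differs at the two ends of uv
    ([representsP]); such an s exists for every lambda ([signs_for_exists]).
    Two sign functions that serve the same lambda differ by a function constant
    on edges, so an embedding is a single nonempty orbit of maps under
    conjugation by switchings ([switch_orbit]), determined by any one of its
    members.

    An isomorphism h between two maps with underlying graph G permutes the
    vertices, since these are read off from the maps.  It respects alpha and
    beta, so this permutation is an automorphism g of G, and the only freedom
    left once g is divided out is to exchange sides: h = g followed by a
    switching ([map_automorphism]).  Switchings preserve every embedding, so
    isomorphic embeddings are related by g itself, and conversely the action
    consists of isomorphisms ([embedding_isoP]). *)

Import GroupScope.

(** * Flags and side switchings *)

Lemma porbitJ (T : finType) (P h : {perm T}) (x : T) :
  porbit (P ^ h) (h x) = h @: porbit P x.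
Proof.
apply/setP=> y; apply/porbitP/imsetP=> [[i ->]|[z /porbitP[i ->] ->]].
  by exists ((P ^+ i) x); rewrite ?mem_porbit // -conjXg permJ.
by exists i; rewrite -conjXg permJ.
Qed.

Section Flags.
Variable G : sgraph.
Implicit Types (u v : G) (x y : flag G) (d : dart G) (rho : {perm dart G}).
Implicit Types (P h : {perm flag G}) (R : embedding G).
Implicit Types (s t : {ffun dart G -> bool}).

Lemma dart_ext (d1 d2 : dart G) :
  dtail d1 = dtail d2 -> dhead d1 = dhead d2 -> d1 = d2.
Proof.
case: d1 d2 => [[u1 v1] a1] [[u2 v2] a2]; rewrite /dtail /dhead /= => e1 e2.
by apply: val_inj; rewrite /= e1 e2.
Qed.

Lemma flag_ext x y : dtail x.1 = dtail y.1 -> dhead x.1 = dhead y.1 ->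
  x.2 = y.2 -> x = y.
Proof. by case: x y => [d b] [e c] /= /dart_ext de /de -> ->. Qed.

Lemma alphaE x : alpha G x = (x.1, ~~ x.2).
Proof. by rewrite permE. Qed.

Lemma betaE x : beta G x = (drev x.1, x.2).
Proof. by rewrite permE. Qed.

Lemma drev_neq d : drev d != d.
Proof.
apply/eqP=> e; have a := valP d; rewrite /= in a.
have : dhead d = dtail d by rewrite -{2}e.
by rewrite /dhead /dtail => e'; rewrite e' adj_irr in a.
Qed.

Lemma edge_of_rev d : edge_of (drev d) = edge_of d.
Proof. by apply: val_inj; rewrite /= setUC. Qed.

Lemma quadricells_flags : quadricells (alpha G) (beta G).
Proof.
apply/forallP=> -[d b].
rewrite !(alphaE, betaE) /= negbK drevK !eqxx /= !xpair_eqE.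
by rewrite eqxx (negbTE (drev_neq d)); case: b.
Qed.

Lemma switch_subproof (s : {ffun dart G -> bool}) :
  injective (fun x : flag G => (x.1, x.2 (+) s x.1)).
Proof. by move=> [d b] [e c] [<- /addIb ->]. Qed.
Definition switch s : {perm flag G} := perm (@switch_subproof s).

Lemma switchE s x : switch s x = (x.1, x.2 (+) s x.1).
Proof. by rewrite permE. Qed.

Lemma switchV s : (switch s)^-1 = switch s.
Proof.
apply/eqP; rewrite eq_invg_mul; apply/eqP/permP=> -[d b].
by rewrite permM !switchE perm1 /= addbK.
Qed.

Lemma switchM s t : switch s * switch t = switch [ffun d => s d (+) t d].
Proof. by apply/permP=> x; rewrite permM !switchE ffunE addbA. Qed.

(** The condition for [switch s] to commute with beta, i.e. to exchange sides
    of whole edges. *)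
Definition edge_invariant s : bool := [forall d, s (drev d) == s d].

(** The condition that ties the signs to lambda in [represents]. *)
Definition signs_for (lambda : {ffun edge G -> bool}) s : bool :=
  [forall d, lambda (edge_of d) == (s d == s (drev d))].

(** Both signs at an edge enter lambda only through their difference. *)
Lemma signs_for_addb lambda s t :
  signs_for lambda s ->
  signs_for lambda [ffun d => s d (+) t d] = edge_invariant t.
Proof.
move=> /forallP Hs; apply: eq_forallb => d; rewrite (eqP (Hs d)) !ffunE.
by case: (s d); case: (s _); case: (t d); case: (t _).
Qed.

Lemma signs_for_exists lambda : exists s, signs_for lambda s.
Proof.
(* An edge with lambda = 0 needs different signs at its ends; comparing the
   ranks of its two ends in an enumeration of the vertices gives such signs. *)
exists [ffun d => lambda (edge_of d) ||
                  (enum_rank (dtail d) < enum_rank (dhead d))%N].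
apply/forallP=> d; rewrite !ffunE edge_of_rev; case: (lambda _) => //=.
have: enum_rank (dtail d) != enum_rank (dhead d).
  apply/eqP=> /enum_rank_inj e; have := valP d.
  by rewrite -/(dtail d) -/(dhead d) e adj_irr.
by rewrite /dtail /dhead /= neq_ltn; case: ltngtP.
Qed.

(** * The maps that represent an embedding *)

Lemma std_map_subproof rho :
  injective (fun x : flag G => ((if x.2 then rho^-1 x.1 else rho x.1), x.2)).
Proof.
by move=> [d b] [e c] [] + ebc; rewrite -{}ebc /=; case: b => /perm_inj->.
Qed.

(** The map of rho with all signs +: the + flags rotate by rho and, as
    alpha P = P^-1 alpha forces, the - flags by its inverse. *)
Definition std_map rho : {perm flag G} := perm (@std_map_subproof rho).

Lemma std_mapE rho x :
  std_map rho x = ((if x.2 then rho^-1 x.1 else rho x.1), x.2).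
Proof. by rewrite permE. Qed.

Lemma porbit_std_map rho x : rotation_system rho ->
  porbit (std_map rho) x =
    [set y | (y.2 == x.2) && (dtail y.1 == dtail x.1)].
Proof.
move=> /forallP Hrho.
have iterE i : (std_map rho ^+ i) x =
    (((if x.2 then rho^-1 else rho) ^+ i) x.1, x.2).
  elim: i => [|i IH]; first by rewrite !expg0 !perm1; case: x.
  by rewrite !expgSr !permM IH std_mapE /=; case: x.2.
have orbE: porbit (if x.2 then rho^-1 else rho) x.1 = porbit rho x.1.
  by case: x.2 => //; rewrite porbitV.
apply/setP=> y; rewrite inE; apply/porbitP/andP=> [[i ->]|[/eqP e]].
  rewrite iterE /= eqxx; split=> //.
  have: ((if x.2 then rho^-1 else rho) ^+ i) x.1 \in porbit rho x.1.
    by rewrite -orbE mem_porbit.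
  by rewrite (eqP (Hrho _)) inE.
have -> : dtail y.1 == dtail x.1 = (y.1 \in porbit rho x.1).
  by rewrite (eqP (Hrho _)) inE.
rewrite -orbE => /porbitP[i ei]; exists i.
by rewrite iterE -ei -e; case: (y).
Qed.

Definition signed_map rho s : {perm flag G} := std_map rho ^ switch s.

(** The bit b (+) s d tells on which of the two conjugate cycles at its vertex
    the flag (d, b) lies. *)
Lemma signed_mapE rho s d b :
  signed_map rho s (d, b) =
    let e := if b (+) s d then rho^-1 d else rho d in
    (e, s e (+) (b (+) s d)).
Proof.
rewrite /signed_map conjgE !permM switchV !switchE !std_mapE /=.
by congr pair; rewrite addbC.
Qed.

Lemma porbit_signed_map rho s x : rotation_system rho ->
  porbit (signed_map rho s) x =
    [set y | (y.2 (+) s y.1 == x.2 (+) s x.1) && (dtail y.1 == dtail x.1)].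
Proof.
move=> Hrho; rewrite -{1}[x](permKV (switch s)) porbitJ porbit_std_map //.
rewrite switchV !switchE /=; apply/setP=> y.
by rewrite -preim_permV !inE /= switchV !switchE.
Qed.

Lemma signed_map_alpha rho s x :
  alpha G (signed_map rho s x) = (signed_map rho s)^-1 (alpha G x).
Proof.
apply: (canRL (permK _)); case: x => d b.
rewrite !signed_mapE !alphaE /= signed_mapE.
case: b; case e: (s d) => /=;
  rewrite ?addbT ?addbF ?addNb ?addbN ?negbK ?addbb /=;
  by rewrite ?permK ?permKV ?e.
Qed.

Lemma underlying_signed_map rho s : rotation_system rho ->
  underlying_graph_is (signed_map rho s).
Proof.
move=> Hrho; apply/forallP=> x; apply/eqP/setP=> y.
rewrite /map_vertex !porbit_signed_map // !inE alphaE /=.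
by case: (dtail _ == _); case: (x.2); case: (y.2); case: (s x.1); case: (s y.1).
Qed.

(** Flags live on darts, so an isolated vertex would have none. *)
Lemma flag_at : connected_graph G -> (0 < max_valency G)%N ->
  forall u, exists x, dtail x.1 = u.
Proof.
move=> G_conn G_val u.
have dart_flag v w : adj v w -> exists x, dtail x.1 = v.
  by move=> a; exists ((exist _ (v, w) a : dart G), false).
have [v [w a]] : exists v w : G, adj v w.
  move: G_val; rewrite lt0n.
  have [|noE] := boolP [exists v : G, exists w, adj v w].
    by case/existsP=> v /existsP[w a] _; exists v, w.
  rewrite /max_valency big1 // => v _; apply: eq_card0 => w; rewrite inE.
  by apply: contraNF noE => a; apply/existsP; exists v; apply/existsP; exists w.
have /connectP[[|w' p] /= ] := G_conn u v; last by case/andP=> /dart_flag.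
by move=> _ <-; apply: dart_flag a.
Qed.

(** P and alpha reach every flag at the current vertex, and beta moves to a
    neighbour. *)
Lemma connected_transitive P :
  connected_graph G -> (0 < max_valency G)%N -> underlying_graph_is P ->
  [transitive <<[set alpha G; beta G; P]>>, on [set: flag G] | 'P].
Proof.
move=> G_conn G_val /forallP HP; set K := <<_>>.
have [aK bK PK] : [/\ alpha G \in K, beta G \in K & P \in K].
  by split; apply: mem_gen; rewrite !inE eqxx ?orbT.
have PiK i : P ^+ i \in K by rewrite groupX.
have stepK (y z : flag G) (k : {perm flag G}) :
    k \in K -> y \in orbit 'P K z -> k y \in orbit 'P K z.
  move=> Kk yz; apply: (orbit_trans _ yz).
  by apply: (mem_orbit (perm_action _)) Kk.
have vertexK (y z x : flag G) : dtail y.1 = dtail z.1 ->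
    z \in orbit 'P K x -> y \in orbit 'P K x.
  move=> e zK; have: y \in map_vertex (alpha G) P z.
    by rewrite (eqP (HP z)) inE e.
  by case/setUP=> /porbitP[i ->]; apply: (stepK); rewrite ?PiK //;
    apply: (stepK).
have pathK x p v y : v = dtail x.1 -> path (@adj G) v p ->
    dtail y.1 = last v p -> y \in orbit 'P K x.
  move=> ev; have: forall z, dtail z.1 = v -> z \in orbit 'P K x.
    by move=> z ez; apply: (vertexK z x); rewrite ?orbit_refl // ez ev.
  elim: p v {ev} => [|w p IH] v Hv /=; first by move=> _; apply: Hv.
  case/andP=> a; apply: IH => z ez.
  pose d : dart G := exist _ (v, w) a.
  apply: (vertexK z (beta G (d, false))); first by rewrite betaE ez.
  by apply: (stepK) => //; apply: Hv.
have [x _] : exists x, x \in [set: flag G].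
  have /card_gt0P[u _] : (0 < #|G|)%N.
    rewrite lt0n; apply: contraTneq G_val => G0.
    rewrite /max_valency big1 // => u.
    by have := fintype0 u.
  by have [x _] := flag_at G_conn G_val u; exists x; rewrite inE.
apply/imsetP; exists x => //; apply/setP=> y; rewrite inE; symmetry.
have /connectP[p pp e] := G_conn (dtail x.1) (dtail y.1).
exact: pathK pp e.
Qed.

(** P is prescribed by rho and s on one of the two conjugate cycles at each
    vertex, and alpha P = P^-1 alpha determines it on the other. *)
Lemma representsP rho lambda P :
  connected_graph G -> (0 < max_valency G)%N -> rotation_system rho ->
  reflect (exists2 s, signs_for lambda s & P = signed_map rho s)
          (represents rho lambda P).
Proof.
move=> G_conn G_val Hrho.
apply: (iffP and3P) => [[Pmap _ /existsP[s /forallP Hs]]|[s Hs ->]].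
  exists s; first by apply/forallP=> d; case/andP: (Hs d).
  have Ps d : P (d, s d) = (rho d, s (rho d)) by apply/eqP; case/andP: (Hs d).
  case/and4P: Pmap => _ _ /forallP PV _.
  apply/permP=> -[d b]; rewrite signed_mapE /=.
  have [-> | nb] := eqVneq b (s d); first by rewrite addbb addbF.
  (* The flag (d, b) is alpha P y for y = (e, s e) with e = rho^-1 d. *)
  have -> : b = ~~ s d by move: nb; case: b; case: (s d).
  rewrite addNb addbb /= addbT; set e := rho^-1 d.
  have := eqP (PV (e, s e)); rewrite Ps permKV !alphaE /= => ->.
  by rewrite permKV.
have under := underlying_signed_map s Hrho.
split=> //; last first.
  apply/existsP; exists s; apply/forallP=> d.
  by rewrite signed_mapE addbb /= addbF eqxx; apply: (forallP Hs).
apply/and4P; split; first exact: quadricells_flags.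
- apply/forallP=> x; rewrite porbit_signed_map // inE alphaE /=.
  by rewrite addNb; case: (_ (+) _).
- by apply/forallP=> x; rewrite signed_map_alpha.
exact: connected_transitive.
Qed.

(** Hence two embeddings with a common map are equal, and conjugation by a
    switching does not lead out of an embedding. *)
Lemma switch_orbit R P : connected_graph G -> (0 < max_valency G)%N ->
  R \in EL G -> P \in R ->
  R = [set P ^ switch t | t : {ffun dart G -> bool} & edge_invariant t].
Proof.
move=> G_conn G_val; rewrite inE.
case/existsP=> rho /existsP[lambda /andP[Hrho /eqP->]].
rewrite inE => /representsP[] // s Hs ->; apply/setP=> Q; rewrite inE.
apply/representsP/imsetP => // [[s' Hs' ->]|[t Ht ->]].
  exists [ffun d => s d (+) s' d].
    rewrite inE -(signs_for_addb _ Hs).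
    by congr (signs_for lambda _): Hs'; apply/ffunP=> d; rewrite !ffunE addKb.
  rewrite -conjgM switchM; congr (_ ^ switch _).
  by apply/ffunP=> d; rewrite !ffunE addKb.
exists [ffun d => s d (+) t d].
  by rewrite signs_for_addb // inE in Ht *.
by rewrite /signed_map -conjgM switchM.
Qed.

Lemma EL_nonempty R : connected_graph G -> (0 < max_valency G)%N ->
  R \in EL G -> exists P, P \in R.
Proof.
move=> G_conn G_val; rewrite inE.
case/existsP=> rho /existsP[lambda /andP[Hrho /eqP->]].
have [s Hs] := signs_for_exists lambda.
by exists (signed_map rho s); rewrite inE; apply/representsP=> //; exists s.
Qed.

Lemma EL_underlying R P : R \in EL G -> P \in R -> underlying_graph_is P.
Proof.
rewrite inE => /existsP[rho /existsP[lambda /andP[_ /eqP->]]].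
by rewrite inE => /and3P[].
Qed.

(** * Isomorphisms of maps and automorphisms of the graph *)

Lemma flag_autM : {in graph_aut G &, {morph @flag_aut G : g k / g * k}}.
Proof.
move=> g k Hg Hk; apply/permP=> x; rewrite permM.
have [t1 h1 b1] := flag_autE x Hg.
have [t2 h2 b2] := flag_autE (flag_aut g x) Hk.
have [t3 h3 b3] := flag_autE x (groupM Hg Hk).
by apply: flag_ext; rewrite ?t3 ?t2 ?t1 ?h3 ?h2 ?h1 ?b3 ?b2 ?b1 ?permM.
Qed.

Lemma flag_aut_alpha (g : {perm G}) : g \in graph_aut G ->
  commute (flag_aut g) (alpha G).
Proof.
move=> Hg; apply/permP=> x; rewrite !permM.
have [t1 h1 b1] := flag_autE x Hg.
have [t2 h2 b2] := flag_autE (alpha G x) Hg.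
by apply: flag_ext; rewrite ?t2 ?h2 ?b2 !alphaE /= ?t1 ?h1 ?b1.
Qed.

Lemma flag_aut_beta (g : {perm G}) : g \in graph_aut G ->
  commute (flag_aut g) (beta G).
Proof.
move=> Hg; apply/permP=> x; rewrite !permM.
have [t1 h1 b1] := flag_autE x Hg.
have [t2 h2 b2] := flag_autE (beta G x) Hg.
by apply: flag_ext; rewrite ?t2 ?h2 ?b2 !betaE.
Qed.

Lemma dart_fixing_switch h :
  commute h (alpha G) -> commute h (beta G) -> (forall x, (h x).1 = x.1) ->
  exists2 t, edge_invariant t & h = switch t.
Proof.
move=> /permP ha /permP hb hd; exists [ffun d => (h (d, false)).2].
  apply/forallP=> d; rewrite !ffunE; apply/eqP.
  by have := hb (d, false); rewrite !permM !betaE /= => <-.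
apply/permP=> -[d b]; rewrite switchE ffunE /=.
have -> : h (d, b) = ((h (d, b)).1, (h (d, b)).2) by case: (h _).
rewrite hd; congr pair; case: b => //.
by have := ha (d, false); rewrite !permM !alphaE /= => <-.
Qed.

(** The vertices of P are sets of flags that h carries to the vertices of P ^ h,
    which gives the automorphism; an isomorphism that also fixes every dart can
    only be a switching. *)
Lemma map_automorphism P h :
  connected_graph G -> (0 < max_valency G)%N ->
  underlying_graph_is P -> underlying_graph_is (P ^ h) ->
  commute h (alpha G) -> commute h (beta G) ->
  exists2 g, g \in graph_aut G &
    exists2 t, edge_invariant t & h = flag_aut g * switch t.
Proof.
move=> G_conn G_val /forallP HP /forallP HPh ha hb.
have haE x : h (alpha G x) = alpha G (h x) by rewrite -!permM ha.
have hbE x : h (beta G x) = beta G (h x) by rewrite -!permM hb.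
have tailE x y : (dtail (h y).1 == dtail (h x).1) = (dtail y.1 == dtail x.1).
  transitivity (h y \in map_vertex (alpha G) (P ^ h) (h x)).
    by rewrite (eqP (HPh _)) inE.
  rewrite /map_vertex -haE !porbitJ -imsetU mem_imset; last exact: perm_inj.
  by rewrite -/(map_vertex _ _ _) (eqP (HP _)) inE.
have at_flag u : exists x, dtail x.1 == u.
  by have [x <-] := flag_at G_conn G_val u; exists x.
pose flg u := xchoose (at_flag u).
have tail_flg u : dtail (flg u).1 = u by apply/eqP/(xchooseP (at_flag u)).
have g_inj : injective (fun u => dtail (h (flg u)).1).
  by move=> u v /eqP; rewrite tailE !tail_flg => /eqP.
pose g := perm g_inj.
have gtail x : g (dtail x.1) = dtail (h x).1.
  by apply/eqP; rewrite permE tailE tail_flg.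
have ghead x : g (dhead x.1) = dhead (h x).1.
  by have := gtail (beta G x); rewrite hbE !betaE.
have Hg : g \in graph_aut G.
  rewrite inE; apply/forallP=> u; apply/forallP=> v; apply/eqP.
  apply/idP/idP=> a.
    pose y : flag G := ((exist _ (g u, g v) a : dart G), false).
    have := valP ((h^-1 y).1); rewrite -/(dtail _) -/(dhead _).
    have -> : dtail (h^-1 y).1 = u.
      by apply: (@perm_inj _ g); rewrite gtail permKV.
    have -> // : dhead (h^-1 y).1 = v.
    by apply: (@perm_inj _ g); rewrite ghead permKV.
  pose y : flag G := ((exist _ (u, v) a : dart G), false).
  have := valP (h y).1; rewrite -/(dtail _) -/(dhead _).
  by rewrite -gtail -ghead.
exists g => //.
have [||x|t Ht e] := @dart_fixing_switch ((flag_aut g)^-1 * h).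
- apply/commute_sym/commuteM; last exact: commute_sym.
  exact/commuteV/commute_sym/flag_aut_alpha.
- apply/commute_sym/commuteM; last exact: commute_sym.
  exact/commuteV/commute_sym/flag_aut_beta.
- rewrite permM; set y := (flag_aut g)^-1%g x.
  have -> : x = flag_aut g y by rewrite permKV.
  have [t1 h1 _] := flag_autE y Hg.
  by apply: dart_ext; rewrite ?t1 ?h1.
by exists t => //; rewrite -e mulKVg.
Qed.

(** * The action on embeddings and its orbits *)

Lemma flag_act_alpha (a : {perm G} * {perm flag G}) : a \in AutA G ->
  commute (flag_act a) (alpha G).
Proof.
case: a => g k /setXP[Hg /cycleP[i /= ->]]; rewrite /flag_act /=.
apply/commute_sym/commuteM; first exact/commute_sym/flag_aut_alpha.
exact/commuteX.
Qed.

Lemma flag_act_beta (a : {perm G} * {perm flag G}) : a \in AutA G ->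
  commute (flag_act a) (beta G).
Proof.
case: a => g k /setXP[Hg /cycleP[i /= ->]]; rewrite /flag_act /=.
apply/commute_sym/commuteM; first exact/commute_sym/flag_aut_beta.
apply: commuteX; apply/permP=> x; rewrite !permM.
by rewrite !(alphaE, betaE).
Qed.

Lemma flag_actM : {in AutA G &, {morph @flag_act G : a b / a * b}}.
Proof.
move=> [g j] [k l] /setXP[Hg /cycleP[i ->]] /setXP[Hk _].
rewrite /flag_act /= flag_autM // !mulgA; congr (_ * _).
rewrite -!mulgA; congr (_ * _).
exact/commuteX/flag_aut_alpha.
Qed.

(** The law of an action holds only on [AutA G]: off the automorphisms
    [flag_aut] may take default values, and [flag_act] is multiplicative only
    because alpha commutes with automorphisms. *)
Lemma embedding_act_is_action : is_action (AutA G) (@embedding_act G).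
Proof.
split=> [a P Q|P a b Ha Hb]; first exact/imset_inj/conjg_inj.
rewrite /embedding_act flag_actM // -imset_comp.
by apply: eq_imset => Q; rewrite /= conjgM.
Qed.
Canonical embedding_action := Action embedding_act_is_action.

Lemma map_isoP P1 P2 :
  reflect (exists2 h, commute h (alpha G) /\ commute h (beta G) & P2 = P1 ^ h)
          (map_iso (alpha G) (beta G) P1 (alpha G) (beta G) P2).
Proof.
apply: (iffP existsP) => [[tau]|].
  case/and5P=> /injectiveP inj _ /forallP ta /forallP tb /forallP tP.
  exists (perm inj); first by split; apply/permP=> x;
    rewrite !permM !(permE inj) ?(eqP (ta x)) ?(eqP (tb x)).
  apply/permP=> x; rewrite -[x](permKV (perm inj)) permJ; set y := _ x.
  by rewrite !(permE inj) (eqP (tP y)).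
case=> h [/permP ha /permP hb] ->; exists [ffun x => h x]; apply/and5P; split.
- by apply/injectiveP=> x y; rewrite !ffunE => /perm_inj.
- by apply/forallP=> y; apply/codomP; exists (h^-1 y); rewrite ffunE permKV.
- by apply/forallP=> x; rewrite !ffunE; have:= ha x; rewrite !permM => ->.
- by apply/forallP=> x; rewrite !ffunE; have:= hb x; rewrite !permM => ->.
by apply/forallP=> x; rewrite !ffunE permJ.
Qed.

(** Isomorphic embeddings lie in one orbit: the switching part of an isomorphism
    preserves embeddings, and what remains is an automorphism of G. *)
Lemma embedding_isoP R1 R2 : connected_graph G -> (0 < max_valency G)%N ->
  R1 \in EL G -> R2 \in EL G ->
  (forall a, a \in AutA G -> embedding_act R1 a \in EL G) ->
  embedding_iso R1 R2 = (R2 \in orbit embedding_action (AutA G) R1).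
Proof.
move=> G_conn G_val E1 E2 E1act.
apply/existsP/orbitP=> [[P1 /andP[RP1 /existsP[P2 /andP[RP2]]]]|[a Ha e]].
  case/map_isoP=> h [ha hb] eP2.
  have u1 := EL_underlying E1 RP1; have := EL_underlying E2 RP2.
  rewrite eP2 => u2.
  have [g Hg [t Ht eh]] := map_automorphism G_conn G_val u1 u2 ha hb.
  have Ha : (g, 1) \in AutA G by rewrite inE Hg group1.
  exists (g, 1) => //=.
  have Eg := E1act _ Ha.
  have RP1g : P1 ^ flag_aut g \in embedding_act R1 (g, 1).
    by apply/imsetP; exists P1 => //; rewrite /flag_act mulg1.
  (* The image of R1 under g and R2 share the map P2, so they coincide. *)
  have RP2g : P2 \in embedding_act R1 (g, 1).
    rewrite (switch_orbit G_conn G_val Eg RP1g); apply/imsetP.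
    by exists t; rewrite ?inE // eP2 eh conjgM.
  rewrite (switch_orbit G_conn G_val Eg RP2g).
  by rewrite (switch_orbit G_conn G_val E2 RP2).
have [P1 RP1] := EL_nonempty G_conn G_val E1.
exists P1; rewrite RP1; apply/existsP; exists (P1 ^ flag_act a).
have -> /= : P1 ^ flag_act a \in R2.
  by rewrite -e; apply/imsetP; exists P1.
apply/map_isoP; exists (flag_act a) => //.
by split; [apply: flag_act_alpha | apply: flag_act_beta].
Qed.

End Flags.

Theorem theorem2p1 (G : sgraph) (E : {set embedding G})
    (G_conn : connected_graph G)
    (G_val : (3 <= max_valency G)%N)
    (E_sub : E \subset EL G)
    (E_inv : forall g, g \in AutA G ->
             forall P, P \in E -> embedding_act P g \in E) :
  ((num_unrooted E)%:R : rat)%R =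
  ((#|AutA G|%:R)^-1 * \sum_(g in AutA G) #|Phi E g|%:R)%R.
Proof.
have G_pos : (0 < max_valency G)%N by apply: leq_trans G_val.
pose A := [group of AutA G].
have acts : [acts A, on E | embedding_action G].
  apply/subsetP=> a Aa; rewrite inE; apply/andP; split=> //.
  rewrite inE; apply/subsetP=> R ER.
  by rewrite inE /=; apply: E_inv.
have -> : num_unrooted E = #|[set orbit (embedding_action G) A R | R in E]|.
  congr #|pred_of_set _|; apply: eq_in_imset => R ER.
  apply/setP=> R'; rewrite inE.
  have orbE : R' \in orbit (embedding_action G) A R -> R' \in E.
    by case/orbitP=> a Aa <-; apply: E_inv.
  apply/andP/idP=> [[ER' iso]|o].
    rewrite -embedding_isoP ?(subsetP E_sub) // => a Aa.
    by rewrite (subsetP E_sub) ?E_inv.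
  rewrite orbE // embedding_isoP ?(subsetP E_sub) ?orbE // => a Aa.
  by rewrite (subsetP E_sub) ?E_inv.
have A_neq0 : (#|AutA G|%:R != 0 :> rat)%R.
  by rewrite Num.Theory.pnatr_eq0 -lt0n (cardG_gt0 A).
apply: (GRing.mulfI A_neq0); rewrite GRing.mulVKf //.
rewrite -GRing.natrM -GRing.natr_sum mulnC -(Frobenius_Cauchy acts).
congr (_%:R)%R; apply: eq_bigr => a Aa; apply: eq_card => R.
by rewrite !inE sub1set inE.
Qed.
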